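(* Let $d<\omega$, let $A$ be a Boolean algebra, and let $f\colon A\to[A]^{<\aleph_0}$ be such that for each $n\le d$ and each $\vec x=(x_0,\dots,x_{n-1})\in A^n$ with $\bigwedge_{i<n}x_i=0$ there exists $$\vec y\in\prod_{i<n}\Big(\langle f(x_i)\rangle\cap\Big\langle\bigcup_{j\ne i}f(x_j)\Big\rangle\Big)$$ with $\bigwedge_{i<n}y_i=0$ and $x_i\le y_i$ for all $i<n$. Then $A$ has the $d$-ary FN.
   Context: $[A]^{<\aleph_0}$ is the set of finite subsets of $A$; $\langle S\rangle$ is the subalgebra of $A$ generated by $S$. For subalgebras $B\le A$, $B\le_{\mathrm{rc}}A$ means that for every $y\in A$ the set $\{x\in B:x\le y\}$ has a maximum. A family $\mathcal{C}\subseteq[A]^{<\aleph_1}$ of countable subsets is a club if it is cofinal under inclusion and closed under unions of countable nonempty chains. For $d\le\omega$, $A$ has the $d$-ary FN if there is a club $\mathcal{E}\subseteq[A]^{<\aleph_1}$ such that $B\le_{\mathrm{rc}}A$ for every subalgebra $B$ generated by a union of fewer than $d$ elements of $\mathcal{E}$. *)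

(* Defs.v *)
From mathcomp Require Import all_boot all_order finmap.
From mathcomp Require Import boolp classical_sets functions cardinality.

Set Implicit Arguments.
Unset Strict Implicit.
Unset Printing Implicit Defensive.

Import Order.Theory.
Local Open Scope classical_set_scope.

Section Subalgebras.
Context {disp : Order.disp_t} {A : ctbDistrLatticeType disp}.

Record is_subalgebra (B : set A) : Prop := IsSubalgebra {
  subalg_bot : B (\bot)%O ;
  subalg_top : B (\top)%O ;
  subalg_meet : forall x y, B x -> B y -> B (x `&` y)%O ;
  subalg_join : forall x y, B x -> B y -> B (x `|` y)%O ;
  subalg_compl : forall x, B x -> B (~` x)%O }.

Definition subalg_gen (S : set A) : set A := smallest is_subalgebra S.

Definition has_max (S : set A) : Prop := exists2 m, S m & ubound S m.

Definition rc_subalgebra (B : set A) : Prop :=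
  is_subalgebra B /\ forall y : A, has_max [set x | B x /\ (x <= y)%O].

End Subalgebras.

Record is_club (T : Type) (E : set (set T)) : Prop := IsClub {
  club_countable : forall X, E X -> countable X ;
  club_cofinal : forall X, countable X -> exists2 Y, E Y & X `<=` Y ;
  club_chain : forall C : set (set T),
    C `<=` E -> C !=set0 -> countable C -> total_on C subset ->
    E (\bigcup_(X in C) X) }.

Definition ary_FN (d : nat) {disp : Order.disp_t}
    (A : ctbDistrLatticeType disp) : Prop :=
  exists2 E : set (set A), is_club E &
    forall (k : nat) (F : set (set A)),
      (k < d)%N -> F `<=` E -> (F #= `I_k)%card ->
      rc_subalgebra (subalg_gen (\bigcup_(X in F) X)).

(* Main.v *)
(** The club consists of the countable subalgebras that are closed under [f].
Let [B] be generated by [k < d] of them and let [y] be in [A]. Every element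
of [B] is a finite join of meets [b_0 /\ ... /\ b_(k-1)], one factor from each
member. If such a meet lies below [y], then [~y, b_0, ..., b_(k-1)] has meet
[0]; the hypothesis interpolates an element of [<f(~y)>] in [B] between the
meet and [y]. Since [<f(~y)>] is finite, the largest element of [<f(~y)>] in
[B] below [y] is the maximum of all elements of [B] below [y]. *)

Require Import Defs.
From mathcomp Require Import all_boot all_order finmap.
From mathcomp Require Import boolp classical_sets functions cardinality.

Set Implicit Arguments.
Unset Strict Implicit.
Unset Printing Implicit Defensive.

Import Order.Theory.
Local Open Scope classical_set_scope.

(** Apply [g] to all pairs and repeat countably often. The stages increase, so two points of the
    union already lie in a common stage, and the next stage contains their [g]-values. *)
Lemma countable_closure (T : Type) (g : T -> T -> set T) (X : set T) :
  (forall x y, countable (g x y)) -> countable X ->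
  exists Y : set T,
    [/\ countable Y, X `<=` Y & forall x y, Y x -> Y y -> g x y `<=` Y].
Proof.
move=> gc Xc.
pose step (Z : set T) := Z `|` \bigcup_(p in Z `*` Z) g p.1 p.2.
pose Z n := iter n step X.
have Z_mono m n : (m <= n)%N -> Z m `<=` Z n.
  move=> /subnK <-; elim: (n - m)%N => // k IH x /IH Zx.
  by rewrite addSn; left.
exists (\bigcup_n Z n); split.
- apply: bigcup_countable => [|n _]; first exact: countableP.
  elim: n => //= n IH.
  rewrite /step -bigcup2E; apply: bigcup_countable => [|[|[|i]] _] //=.
  by apply: bigcup_countable => [|p _]; [exact: countableX|exact: gc].
- by move=> x Xx; exists 0%N.
- move=> x y [m _ Zmx] [n _ Zny] z gz; exists (maxn m n).+1 => //=.
  right; exists (x, y) => //=; split => /=.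
    exact: Z_mono (leq_maxl m n) _ Zmx.
  exact: Z_mono (leq_maxr m n) _ Zny.
Qed.

Section Subalgebra.
Context {disp : Order.disp_t} {A : ctbDistrLatticeType disp}.
Implicit Types (B C S : set A) (a b x y : A).

Lemma subalg_gen_subalgebra S : is_subalgebra (subalg_gen S).
Proof.
split.
- by move=> B [] [].
- by move=> B [] [].
- move=> x y Sx Sy B BS; have [[_ _ BI _ _] _] := BS.
  by apply: BI; [apply: Sx|apply: Sy].
- move=> x y Sx Sy B BS; have [[_ _ _ BU _] _] := BS.
  by apply: BU; [apply: Sx|apply: Sy].
- by move=> x Sx B BS; have [[_ _ _ _ BC] _] := BS; apply: BC; apply: Sx.
Qed.

Lemma subalgebra_bigcup_chain (D : set (set A)) :
  D !=set0 -> total_on D subset -> (forall B, D B -> is_subalgebra B) ->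
  is_subalgebra (\bigcup_(B in D) B).
Proof.
move=> [B0 DB0] Dtot Dsub.
have common x y : (\bigcup_(B in D) B) x -> (\bigcup_(B in D) B) y ->
    exists2 B, D B & B x /\ B y.
  move=> [B DB Bx] [C DC Cy].
  by case: (Dtot B C DB DC) => [BC|CB]; [exists C|exists B] => //; split=> //;
    [exact: BC|exact: CB].
split.
- by exists B0 => //; case: (Dsub _ DB0).
- by exists B0 => //; case: (Dsub _ DB0).
- move=> x y Ux Uy; have [B DB [Bx By]] := common _ _ Ux Uy.
  by exists B => //; apply: subalg_meet => //; exact: Dsub.
- move=> x y Ux Uy; have [B DB [Bx By]] := common _ _ Ux Uy.
  by exists B => //; apply: subalg_join => //; exact: Dsub.
- by move=> x [B DB Bx]; exists B => //; apply: subalg_compl => //; exact: Dsub.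
Qed.

(** The complement relative to [a] depends only on the trace on [a]; this is [rel]. *)
Lemma meet_compl_eq a x b :
  (x `&` a = b `&` a)%O -> (~` x `&` a = ~` b `&` a)%O.
Proof.
have rel z : (~` z `&` a = ~` (z `&` a) `&` a)%O.
  by rewrite complI meetUl meetCx joinx0.
by move=> e; rewrite rel e -rel.
Qed.

Lemma join_meet_compl a x : ((x `&` a) `|` (x `&` ~` a) = x)%O.
Proof. by rewrite -meetUr joinxC meetx1. Qed.

(* The subalgebra generated by [C] and [a] consists of the [x] that agree
   with an element of [C] below [a] and with another one below [~` a]. *)
Lemma finite_subalgebra_adjoin C a :
  is_subalgebra C -> finite_set C ->
  exists B, [/\ is_subalgebra B, finite_set B, C `<=` B & B a].
Proof.
move=> Csub Cfin; have [C0 C1 CI CU CC] := Csub.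
pose agree c x := exists2 b, C b & (x `&` c = b `&` c)%O.
have agree_subalg c : is_subalgebra (agree c).
  split; [by exists \bot%O|by exists \top%O| | |].
  - move=> x y [b Cb e] [b' Cb' e']; exists (b `&` b')%O; first exact: CI.
    by rewrite -[c]meetxx !(meetACA _ _ c) e e'.
  - move=> x y [b Cb e] [b' Cb' e']; exists (b `|` b')%O; first exact: CU.
    by rewrite !meetUl e e'.
  - move=> x [b Cb e]; exists (~` b)%O; first exact: CC.
    exact: meet_compl_eq.
exists (agree a `&` agree (~` a)%O); split.
- have [? ? aI aU aC] := agree_subalg a.
  have [? ? bI bU bC] := agree_subalg (~` a)%O.
  split=> //.
  + by move=> x y [? ?] [? ?]; split; [exact: aI|exact: bI].
  + by move=> x y [? ?] [? ?]; split; [exact: aU|exact: bU].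
  + by move=> x [? ?]; split; [exact: aC|exact: bC].
(* The two witnesses [b], [b'] in [C] determine [x], so there are at most as many elements as pairs
   from [C]. *)
- apply: sub_finite_set (finite_image2
    (fun b b' => (b `&` a) `|` (b' `&` ~` a))%O Cfin Cfin).
  move=> x [[b Cb e] [b' Cb' e']]; exists b => //; exists b' => //.
  by rewrite -e -e' join_meet_compl.
- by move=> x Cx; split; exists x.
- by split; [exists \top%O; rewrite // meetxx meet1x
            |exists \bot%O; rewrite // meetxC meet0x].
Qed.

(** Start from the two-element subalgebra and adjoin the members of [s] one at a time, staying
    finite. *)
Lemma finite_subalg_gen (s : seq A) : finite_set (subalg_gen [set` s]).
Proof.
suff [B [Bsub Bfin sB]] :
    exists B, [/\ is_subalgebra B, finite_set B & [set` s] `<=` B].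
  by apply: sub_finite_set Bfin; exact: smallest_sub.
elim: s => [|a s [B [Bsub Bfin sB]]].
  exists [set \bot%O; \top%O]; split => //; split => [| |x y|x y|x] /=.
  - by left.
  - by right.
  - by move=> [->|->] [->|->]; rewrite ?meetxx ?meet0x ?meetx0; auto.
  - by move=> [->|->] [->|->]; rewrite ?joinxx ?join1x ?joinx1; auto.
  - by move=> [->|->]; rewrite ?compl0 ?compl1; auto.
have [C [Csub Cfin BC Ca]] := finite_subalgebra_adjoin a Bsub Bfin.
exists C; split => // x /=; rewrite inE => /orP[/eqP->//|/sB]; exact: BC.
Qed.

Lemma finite_join_closed_has_max S : finite_set S -> S \bot%O ->
  (forall x y, S x -> S y -> S (x `|` y)%O) -> has_max S.
Proof.
move=> /finite_seqP[s eS] S0 SU; exists (\join_(x <- s) x)%O.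
  rewrite big_seq; elim/big_ind: _ => // x.
  by move=> xs; rewrite eS.
by move=> x; rewrite eS /= => xs; exact: joins_sup_seq.
Qed.

(** Built from the empty join by one joinand at a time, so that a property stable under joins is
    checked by induction on members of [M]. *)
Inductive finite_joins (M : set A) : set A :=
| finite_joins_bot : finite_joins M \bot%O
| finite_joins_join m x :
    M m -> finite_joins M x -> finite_joins M (m `|` x)%O.

Section MeetClosed.
Context (M : set A) (MI : forall x y, M x -> M y -> M (x `&` y)%O).

Lemma finite_joins_incl : M `<=` finite_joins M.
Proof.
by move=> m Mm; rewrite -[m]joinx0; apply: finite_joins_join => //; left.
Qed.

Lemma finite_joinsU x y :
  finite_joins M x -> finite_joins M y -> finite_joins M (x `|` y)%O.
Proof.
elim=> [|m z Mm _ IH] My; first by rewrite join0x.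
by rewrite -joinA; apply: finite_joins_join => //; exact: IH.
Qed.

Lemma finite_joinsI x y :
  finite_joins M x -> finite_joins M y -> finite_joins M (x `&` y)%O.
Proof.
move=> Mx My; elim: Mx => [|m z Mm _ IH]; first by rewrite meet0x; left.
rewrite meetUl; apply: finite_joinsU IH.
elim: My => [|m' z' Mm' _ IH']; first by rewrite meetx0; left.
by rewrite meetUr; apply: finite_joins_join => //; exact: MI.
Qed.

(** By De Morgan the complement of a join is a meet of complements, so complements need checking on
    [M] only. *)
Lemma finite_joins_subalgebra : M \top%O ->
  (forall m, M m -> finite_joins M (~` m)%O) ->
  is_subalgebra (finite_joins M).
Proof.
move=> M1 MC; split.
- exact: finite_joins_bot.
- exact: finite_joins_incl.
- exact: finite_joinsI.
- exact: finite_joinsU.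
- move=> x; elim=> [|m y Mm _ IH].
    by rewrite compl0; exact: finite_joins_incl.
  by rewrite complU; apply: finite_joinsI => //; exact: MC.
Qed.

End MeetClosed.

(** A disjunctive normal form: several factors from the same [G i] merge into one, and the
    complement of a meet is a join of elements of the [G i]. *)
Lemma subalg_gen_bigcup_finite_joins k (G : 'I_k -> set A) :
  (forall i, is_subalgebra (G i)) ->
  subalg_gen (\bigcup_i G i) `<=`
    finite_joins [set m | exists2 b : 'I_k -> A,
      (forall i, G i (b i)) & m = (\meet_(i < k) b i)%O].
Proof.
move=> Gsub; set M := [set m | _].
have M1 : M \top%O.
  exists (fun=> \top%O); first by move=> i; case: (Gsub i).
  by rewrite big1.
have MI x y : M x -> M y -> M (x `&` y)%O.
  move=> [b Gb ->] [c Gc ->]; exists (fun i => b i `&` c i)%O.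
    by move=> i; exact: subalg_meet.
  by rewrite big_split.
have MG i x : G i x -> M x.
  (* Pad with top at the other indices. *)
  move=> Gx; exists (fun j => if j == i then x else \top%O).
    by move=> j; case: eqP => [->//|_]; case: (Gsub j).
  by rewrite -big_mkcond big_pred1_eq.
apply: smallest_sub => [|x [i _ Gx]].
  apply: finite_joins_subalgebra => // m [b Gb ->].
  rewrite compl_meets; elim/big_ind: _ => [|x y|i _].
  - exact: finite_joins_bot.
  - exact: finite_joinsU.
  - by apply/finite_joins_incl/(MG i); apply: subalg_compl.
by apply/finite_joins_incl/(MG i).
Qed.

End Subalgebra.

Theorem theorem2p22 (d : nat) (disp : Order.disp_t)
    (A : ctbDistrLatticeType disp) (f : A -> {fset A})
    (hf : forall (n : nat) (x : 'I_n -> A), (n <= d)%N ->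
      (\meet_(i < n) x i)%O = (\bot)%O ->
      exists y : 'I_n -> A,
        [/\ forall i, (subalg_gen [set` f (x i)] `&`
              subalg_gen (\bigcup_(j in [set j | j <> i]) [set` f (x j)])) (y i),
            (\meet_(i < n) y i)%O = (\bot)%O
          & forall i, (x i <= y i)%O]) :
  ary_FN d A.
Proof.
pose E := [set B : set A | [/\ countable B, is_subalgebra B
  & forall x, B x -> [set` f x] `<=` B]].
exists E.
  split.
  - by move=> X [].
  - move=> X Xc.
    (* One set-valued operation bundles the Boolean operations with [f]; the unary ones ignore [y].
       Bottom is added to [X] below, since [X] may be empty; top is then its complement. *)
    pose g (x y : A) : set A := [set z | z \in
      [:: (x `&` y)%O, (x `|` y)%O, (~` x)%O & f x]].
    have [||Y [Yc XY gY]] := @countable_closure _ g (\bot%O |` X).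
    + by move=> x y; apply/finite_set_countable/finite_seqP; eexists.
    + rewrite -bigcup2E; apply: bigcup_countable => [|[|[|i]] _] //=.
    have Y0 : Y \bot%O by apply: XY; left.
    have YC x : Y x -> Y (~` x)%O.
      by move=> Yx; apply: (gY x x) => //; rewrite /g /= !inE eqxx !orbT.
    exists Y; last by move=> x Xx; apply: XY; right.
    split=> //; last first.
      by move=> x Yx z /= zf; apply: (gY x x) => //; rewrite /g /= !inE zf !orbT.
    split=> //.
    + by rewrite -compl0; exact: YC.
    + by move=> x y Yx Yy; apply: (gY x y) => //; rewrite /g /= !inE eqxx.
    + by move=> x y Yx Yy; apply: (gY x y) => //; rewrite /g /= !inE eqxx orbT.
  - move=> C CE C0 Cc Ctot; split.
    + by apply: bigcup_countable => // X /CE[].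
    + by apply: subalgebra_bigcup_chain => // X /CE[].
    + move=> x [X CX Xx] z zf; exists X => //.
      by have [_ _ Xf] := CE _ CX; exact: Xf zf.
move=> k F kd FE; rewrite card_eq_sym => /card_set_bijP[h hbij].
pose G (i : 'I_k) := h i.
have FG : \bigcup_(X in F) X = \bigcup_i G i.
  apply/seteqP; split=> x [].
    move=> X /(set_bij_surj hbij)[i /= ik <-] hx.
    by exists (Ordinal ik).
  by move=> i _ Gx; exists (G i) => //; apply: (set_bij_sub hbij); exists (val i) => /=.
have GE i : E (G i).
  apply/FE/(set_bij_sub hbij); exists (i : nat) => //=.
rewrite FG; set B := subalg_gen _.
have Bsub : is_subalgebra B by exact: subalg_gen_subalgebra.
have GB i : G i `<=` B by move=> x Gx; apply: sub_gen_smallest; exists i.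
split=> // y.
pose W := subalg_gen [set` f (~` y)%O].
have Wsub : is_subalgebra W by exact: subalg_gen_subalgebra.
have [|||m [[Wm Bm] my] mmax] :=
    @finite_join_closed_has_max _ A ((W `&` B) `&` [set x | (x <= y)%O]).
- by do 2 apply: finite_setIl; exact: finite_subalg_gen.
- by split=> /=; [split; exact: subalg_bot|exact: le0x].
- move=> x z [[Wx Bx] /= xy] [[Wz Bz] /= zy]; split=> /=.
    by split; [exact: (subalg_join Wsub)|exact: (subalg_join Bsub)].
  by rewrite leUx xy.
exists m => // x [/subalg_gen_bigcup_finite_joins Bx].
have {}Bx := Bx (fun i => let: And3 _ s _ := GE i in s).
(* A join lies below [y], or below [m], exactly when its joinands do, so a single meet of the [b i]
   remains to be treated. *)
elim: Bx => [|c {}x [b Gb ->] _ IH]; first by rewrite le0x.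
rewrite !leUx => /andP[cy /IH->]; rewrite andbT {x IH}.
pose u (i : 'I_k.+1) := oapp b (~` y)%O (unlift ord0 i).
have u0 : u ord0 = (~` y)%O by rewrite /u unlift_none.
have uS i : u (lift ord0 i) = b i by rewrite /u liftK.
have [||v [vf v0 uv]] := hf k.+1 u.
- by [].
- rewrite big_ord_recl u0 (eq_bigr b) => [|i _]; last exact: uS.
  by apply/eqP; rewrite disj_leC leC.
(* The interpolant is [~] z[: it is above the meet of the]b i[because the]v
   i[meet to bottom, and below]y[because]~[y <= z]. *)
pose z := v ord0.
have bz : (\meet_(i < k) b i <= ~` z)%O.
  apply: (@le_trans _ _ (\meet_(i < k) v (lift ord0 i))%O).
    elim/big_ind2: _ => // [? ? ? ?|i _]; first exact: leI2.
    by rewrite -uS.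
  by rewrite lexC -disj_leC -v0 big_ord_recl.
apply: (le_trans bz); apply: mmax; split=> /=; last first.
  by rewrite leCx -u0; exact: uv.
have [Wz Bz] := vf ord0.
split.
  by apply: (subalg_compl Wsub); rewrite /W -u0.
apply: (subalg_compl Bsub).
(* An index other than 0 carries some [b i], and [G i] is closed under [f], so all generators
   [f (b i)] lie in [B]. *)
apply: smallest_sub Bz => // a [j /= j0 fa].
have [i ji] := unlift_some (introN eqP (nesym j0)).
move: fa; rewrite ji uS => fa _; apply: (GB i).
by have [_ _ Gf] := GE i; exact: Gf (Gb i) _ fa.
Qed.
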